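(* The problem 2-FREE-FLOOD-IT is solvable in polynomial time on arbitrary graphs: given a finite connected graph $G$ with a vertex colouring using at most two colours, the minimum number of moves needed to make $G$ monochromatic can be computed in time polynomial in the size of $G$.
   Context: Free-Flood-It on a graph: given a graph $G$ with vertex colouring $\omega$ from a colour-set $C$, a move $(v,d)$ (any vertex $v$, any colour $d\in C$) gives colour $d$ to every vertex of the monochromatic connected component containing $v$ in the current colouring. The goal is to make every vertex the same colour using as few moves as possible. 2-FREE-FLOOD-IT is this minimisation problem when only colours from a fixed set of size $2$ are used. *)

(* Defs.v *)
From HB Require Import structures.
From mathcomp Require Import all_boot all_order all_algebra.

Set Implicit Arguments.
Unset Strict Implicit.
Unset Printing Implicit Defensive.

(** Random access machines in the style of Cook and Reckhow (1973), over the
    natural numbers, with a read-only input tape and a write-only output tape.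
    Every instruction costs one step. The only arithmetic is addition and
    truncated subtraction, so starting from the program constants and the input
    the maximal bit length of a register grows by at most one per step, and polynomial time here agrees with polynomial time on Turing
    machines. *)

Inductive ram_instr : Type :=
| IConst of nat & nat           (* X_i <- c *)
| IAdd of nat & nat & nat       (* X_i <- X_j + X_k *)
| ISub of nat & nat & nat       (* X_i <- X_j - X_k *)
| ILoad of nat & nat            (* X_i <- X_(X_j) *)
| IStore of nat & nat           (* X_(X_i) <- X_j *)
| IJump of nat & nat            (* if X_i > 0 then go to l *)
| IRead of nat                  (* X_i <- next input symbol, 0 if there is none *)
| IPrint of nat.                (* output X_i *)

Definition ram_program := seq ram_instr.

Record ram_config : Type := RamConfig {
  ram_pc : nat;
  ram_reg : nat -> nat;
  ram_in : seq nat;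
  ram_out : seq nat
}.

Definition ram_init (input : seq nat) : ram_config :=
  RamConfig 0 (fun=> 0) input [::].

Definition ram_set (X : nat -> nat) (i a : nat) : nat -> nat :=
  fun j => if j == i then a else X j.

Definition ram_exec (c : ram_config) (i : ram_instr) : ram_config :=
  let: RamConfig pc X inp out := c in
  match i with
  | IConst i a => RamConfig pc.+1 (ram_set X i a) inp out
  | IAdd i j k => RamConfig pc.+1 (ram_set X i (X j + X k)) inp out
  | ISub i j k => RamConfig pc.+1 (ram_set X i (X j - X k)) inp out
  | ILoad i j => RamConfig pc.+1 (ram_set X i (X (X j))) inp out
  | IStore i j => RamConfig pc.+1 (ram_set X (X i) (X j)) inp out
  | IJump i l => RamConfig (if 0 < X i then l else pc.+1) X inp out
  | IRead i => RamConfig pc.+1 (ram_set X i (head 0 inp)) (behead inp) out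
  | IPrint i => RamConfig pc.+1 X inp (rcons out (X i))
  end.

(** The machine halts when the program counter leaves the program; from then on
    [ram_step] is the identity. *)
Definition ram_halted (P : ram_program) (c : ram_config) : bool :=
  size P <= ram_pc c.

Definition ram_step (P : ram_program) (c : ram_config) : ram_config :=
  if onth P (ram_pc c) is Some i then ram_exec c i else c.

Definition ram_outputs_within
    (P : ram_program) (input : seq nat) (t : nat) (output : seq nat) : Prop :=
  let c := iter t (ram_step P) (ram_init input) in
  ram_halted P c /\ ram_out c = output.

Section Graph.
Variables (T : finType) (e : rel T).

Definition simple_graph : Prop := symmetric e /\ irreflexive e.

Definition connected_graph : Prop :=
  0 < #|T| /\ forall x y : T, connect e x y.

Definition edge_set : {set {set T}} :=
  [set A : {set T} | [exists x, exists y, e x y && (A == [set x; y])]].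

Definition graph_size : nat := #|T| + #|edge_set|.

Section Flood.
Variable C : finType.

Definition mono_component (w : {ffun T -> C}) (v : T) : {set T} :=
  [set u | connect [rel x y | e x y && (w x == w y)] v u].

Definition flood_move (w : {ffun T -> C}) (m : T * C) : {ffun T -> C} :=
  [ffun u => if u \in mono_component w m.1 then m.2 else w u].

Definition flood_play (w : {ffun T -> C}) (s : seq (T * C)) : {ffun T -> C} :=
  foldl flood_move w s.

Definition monochromatic (w : {ffun T -> C}) : Prop :=
  exists d : C, forall v : T, w v = d.

Definition min_moves (w : {ffun T -> C}) (m : nat) : Prop :=
  (exists2 s : seq (T * C), size s = m & monochromatic (flood_play w s)) /\
  (forall s : seq (T * C), monochromatic (flood_play w s) -> m <= size s).

End Flood.
End Graph.

(** The number of vertices, the list of colours, then the adjacency matrix row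
    by row. *)
Definition encode_instance (n k : nat) (e : rel 'I_n)
    (w : {ffun 'I_n -> 'I_k}) : seq nat :=
  n :: [seq (w v : nat) | v <- enum 'I_n]
    ++ [seq nat_of_bool (e u v) | u <- enum 'I_n, v <- enum 'I_n].

(* Main.v *)
Require Import Defs.
From HB Require Import structures.
From mathcomp Require Import all_boot all_order all_algebra zify.

Set Implicit Arguments.
Unset Strict Implicit.
Unset Printing Implicit Defensive.

(** For two colours the minimum number of moves is the radius of the graph for
    the distance that counts colour changes along a walk. Flooding always at a
    centre lowers its eccentricity by one per move. Conversely, let a move at
    [v] lead to a colouring with centre [x] and radius [r]. Walks that avoid the
    flooded component keep their cost, and walks through it lose at most one
    change on either side; so the vertex reached from [x] by one colour change
    towards [v] has eccentricity at most [r + 1] before the move. The radius is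
    computed by the Floyd-Warshall algorithm, run on the machine in time
    [O(n^3)]. *)

(** * Colour-change distance *)

Section ColourDistance.
Variables (T : finType) (e : rel T).

(** The index bounds the colour changes along some walk instead of counting them exactly, so that
    slack can be absorbed at any edge. *)
Inductive reach (C : finType) (w : {ffun T -> C}) : nat -> T -> T -> Prop :=
| reach_refl k x : reach w k x x
| reach_edge j k x y z :
    reach w j x y -> e y z -> j + (w y != w z) <= k -> reach w k x z.

Section AnyColours.
Variables (C : finType) (w : {ffun T -> C}).

Lemma reach_leq j k x y : j <= k -> reach w j x y -> reach w k x y.
Proof.
move=> jk r; case: r jk => [k0 x0 _|i k0 x0 y0 z0 r0 eyz le0 jk].
  exact: reach_refl.
by apply: (reach_edge r0 eyz); apply: leq_trans jk.
Qed.

Lemma reach_trans j k x y z :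
  reach w j x y -> reach w k y z -> reach w (j + k) x z.
Proof.
move=> rxy ryz; elim: ryz rxy => [k0 x0|i k0 x0 y0 z0 _ IH eyz le0] r.
  exact: reach_leq (leq_addr _ _) r.
by apply: (reach_edge (IH r) eyz); lia.
Qed.

Lemma reach1 x y : e x y -> reach w (w x != w y) x y.
Proof. by move=> exy; apply: (reach_edge (reach_refl w 0 x) exy). Qed.

Lemma reach_mono_component v u : u \in mono_component e w v -> reach w 0 v u.
Proof.
rewrite inE => /connectP[p]; elim: p v => [|y p IH] v /=.
  by move=> _ ->; apply: reach_refl.
case/andP=> /andP[evy /eqP wvy] pth lst.
apply: (@reach_trans 0 0 _ y); last exact: IH.
by have := reach1 evy; rewrite wvy eqxx.
Qed.

Lemma reach_path x p : path e x p -> reach w (size p) x (last x p).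
Proof.
elim: p x => [|y p IH] x /=; first by move=> _; apply: reach_refl.
case/andP=> exy /IH r; rewrite -add1n; apply: reach_trans r.
by apply: reach_leq (reach1 exy); case: (_ != _).
Qed.

(** A simple path has fewer than [#|T|] edges, each changing colour at most once. This lets [n]
    stand for infinity in the distance matrix. *)
Lemma connect_reach x y : connect e x y -> reach w #|T| x y.
Proof.
case/connectP=> p pth ->; case: (shortenP pth) => q qth uq _.
apply: reach_leq (reach_path qth); apply: ltnW.
by have := max_card [in x :: q]; rewrite (card_uniqP uq).
Qed.

Lemma reach0_colour x y : reach w 0 x y -> w x = w y.
Proof.
move E: 0 => k r; elim: r E => // j k0 x0 y0 z0 _ IH _ le0 k00.
have [j0 /eqP] : j = 0 /\ w y0 == w z0 by case: eqP le0 => ? ?; split=> //; lia.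
by move<-; apply: IH; rewrite j0.
Qed.

(** While the prefix has budget 0 the cut point moves along to the end of the walk; after that it
    stays fixed. *)
Lemma reach_split k x y :
  reach w k.+1 x y -> exists2 z, reach w 1 x z & reach w k z y.
Proof.
move E: k.+1 => k' r; elim: r k E => [k0 x0 k _|j k0 x0 y0 z0 r0 IH eyz le0 k kE].
  by exists x0; apply: reach_refl.
case: j r0 IH le0 => [|j] r0 IH le0.
  exists z0; last exact: reach_refl.
  by apply: (reach_edge r0 eyz); case: (_ != _).
have [z rxz rzy] := IH _ erefl; exists z => //.
by apply: (reach_edge rzy eyz); lia.
Qed.

Hypothesis esym : symmetric e.

Lemma reach_sym k x y : reach w k x y -> reach w k y x.
Proof.
elim=> [k0 x0|j k0 x0 y0 z0 _ IH eyz le0]; first exact: reach_refl.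
apply: (@reach_leq ((w y0 != w z0) + j)); first by lia.
by apply: reach_trans IH; rewrite eq_sym; apply: reach1; rewrite esym.
Qed.

(** * Effect of one move on colour-change distances *)

Section Move.
Variables (v : T) (c : C).
Let w' := flood_move e w (v, c).
Let M := mono_component e w v.

Lemma flood_move_in u : u \in M -> w' u = c.
Proof. by rewrite ffunE /= => ->. Qed.

Lemma flood_move_out u : u \notin M -> w' u = w u.
Proof. by rewrite ffunE /= => /negbTE ->. Qed.

Lemma mono_component_step u z :
  u \in M -> e u z -> z \notin M -> w u != w z.
Proof.
rewrite !inE => uM euz; apply: contra => wuz.
by apply: connect_trans uM _; apply: connect1; rewrite /= euz.
Qed.

Lemma reach_flood_in u : u \in M -> reach w' 0 v u.
Proof.
suff sub p x : x \in M -> reach w' 0 v x ->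
    path [rel x y | e x y && (w x == w y)] x p -> reach w' 0 v (last x p).
  rewrite inE => /connectP[p pth ->].
  by apply: sub pth; [rewrite inE | apply: reach_refl].
elim: p x => [|y p IH] x //= xM rx /andP[/andP[exy wxy] pth].
have yM : y \in M.
  by apply: contraLR wxy => yM; apply: mono_component_step yM.
apply: (IH y yM _ pth); apply: (reach_edge rx exy).
by rewrite !flood_move_in // eqxx.
Qed.

(** Cut the walk at its first and last visits to [M]. Of the two outer pieces, only the edge
    entering and the edge leaving [M] can cost more before the move, one unit each; inside [M]
    moving to or from [v] is free. *)
Lemma reach_before_move k x u : reach w' k x u ->
  reach w k x u \/
  exists d d', [/\ d + d' <= k, reach w d.+1 x v & reach w d'.+1 v u].
Proof.
have inM z j : z \in M -> reach w j v z.
  by move=> zM; apply: reach_leq (reach_mono_component zM).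
(* The induction must remember whether the walk has met [M]: the first alternative keeps the
   endpoint outside, so an edge leaving [M] always falls under the second. *)
suff: reach w' k x u -> u \notin M /\ reach w k x u \/
    exists d d', [/\ d + d' <= k, reach w d.+1 x v & reach w d'.+1 v u].
  by move=> sub /sub[[_ ?]|]; [left | right].
elim=> [k0 x0|j k0 x0 y z r IH eyz le0].
  have [xM|xM] := boolP (x0 \in M); last by left; split=> //; apply: reach_refl.
  right; exists 0, 0; split=> //; last exact: inM.
  exact/reach_sym/inM.
have [zM|zM] := boolP (z \in M).
  right; case: IH => [[_ r1]|[d [d' [dd r1 r2]]]].
    exists j, 0; split; [lia | | exact: inM].
    rewrite -(addn0 j.+1); apply: (@reach_trans _ _ _ z); last exact/reach_sym/inM.
    by apply: (reach_edge r1 eyz); rewrite -addn1 leq_add2l; case: (_ != _).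
  by exists d, d'; split; [lia | | exact: inM].
have [yM|yM] := boolP (y \in M).
  case: IH => [[]|[d [d' [dd r1 r2]]]]; first by rewrite yM.
  right; exists d, d'; split; [lia | done |].
  by apply: (reach_edge (inM y 0 yM) eyz); case: (_ != _).
move: le0; rewrite !flood_move_out // => le0.
case: IH => [[_ r1]|[d [d' [dd r1 r2]]]].
  by left; split=> //; apply: (reach_edge r1 eyz).
right; exists d, (d' + (w y != w z)); split; [lia | done |].
by apply: (reach_edge r2 eyz); rewrite addSn.
Qed.

(* The old centre is found one colour change closer to the flooded component
   than the new one. *)
Lemma radius_before_move (D : T -> T -> nat) r :
  (forall k x y, reach w k x y <-> D x y <= k) ->
  (exists x, forall y, reach w' r x y) -> exists x, forall y, reach w r.+1 x y.
Proof.
move=> DP [x rx]; have Dxv : reach w (D x v) x v by apply/DP.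
case E: (D x v) Dxv => [|d0] Dxv.
  exists x => y; have [r1|[d [d' [dd r1 r2]]]] := reach_before_move (rx y).
    exact: reach_leq r1.
  by apply: (@reach_leq (0 + d'.+1)); [lia | apply: reach_trans Dxv r2].
have [z rxz rzv] := reach_split Dxv.
exists z => y; have [r1|[d [d' [dd r1 r2]]]] := reach_before_move (rx y).
  by rewrite -add1n; apply: reach_trans r1; apply: reach_sym.
(* Minimality of [D x v] gives [d0 <= d]: the step from [x] to [z] makes up for the extra change
   before the component. *)
apply: (@reach_leq (d0 + d'.+1)); last exact: reach_trans rzv r2.
by move/DP: r1; lia.
Qed.

End Move.
End AnyColours.

(** * Two colours: radius and number of moves *)

Section TwoColours.
Implicit Types w : {ffun T -> 'I_2}.

Definition flip (c : 'I_2) : 'I_2 := if c == ord0 then ord_max else ord0.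

Lemma neq_flip (a b : 'I_2) : a != b -> flip a = b.
Proof.
by case: a b => [[|[|?]] ?] [[|[|?]] ?] //= _; rewrite /flip; apply: val_inj.
Qed.

(** A walk first leaves [M] along a colour change. With only two colours the outer neighbour already
    has the flipped colour, so this change disappears. *)
Lemma reach_after_flip w r x y : reach w r.+1 x y ->
  reach (flood_move e w (x, flip (w x))) r x y.
Proof.
set w' := flood_move _ _ _; set M := mono_component e w x.
have xM : x \in M by rewrite inE.
have Mcol u : u \in M -> w x = w u.
  by move=> uM; apply: reach0_colour (reach_mono_component uM).
have inM k u : u \in M -> reach w' k x u.
  by move=> uM; apply: reach_leq (reach_flood_in _ uM).
(* The second conjunct prevents truncation in [k.-1]: outside [M] at least one change has been
   spent, so later costs add up correctly. *)
suff sub k u : reach w k x u -> reach w' k.-1 x u /\ (u \notin M -> 0 < k).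
  by case/sub.
move Ex: {1}x => x0 r0; elim: r0 Ex => {k u} [k0 x1 <-|j k0 x1 u z r1 IH euz le0 Ex].
  by split; [apply: inM | rewrite xM].
have [zM|zM] := boolP (z \in M); first by split=> //; apply: inM.
have [r2 j0] := IH Ex.
have [uM|uM] := boolP (u \in M).
  have wuz := mono_component_step uM euz zM.
  have k0_gt0 : 0 < k0 by move: le0; rewrite wuz; lia.
  split=> //; apply: (reach_edge (inM 0 u uM) euz).
  by rewrite flood_move_in // flood_move_out // (Mcol u uM) (neq_flip wuz) eqxx.
have {}j0 := j0 uM; split=> [|_]; last by lia.
by apply: (reach_edge r2 euz); rewrite !flood_move_out //; lia.
Qed.

Lemma radius_play w r : (exists x, forall y, reach w r x y) ->
  exists2 s : seq (T * 'I_2), size s = r & monochromatic (flood_play e w s).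
Proof.
case=> x; elim: r w => [|r IH] w rx.
  by exists [::] => //; exists (w x) => y; apply/esym/reach0_colour.
have [y|s sr ms] := IH (flood_move e w (x, flip (w x))).
  exact: reach_after_flip.
by exists ((x, flip (w x)) :: s) => //=; rewrite sr.
Qed.

(** The final colouring has radius 0, and [radius_before_move] goes back one move at a time. The
    distance function is asked for every colouring because the induction changes it. *)
Lemma play_radius w s : symmetric e -> connected_graph e ->
  (forall w0 : {ffun T -> 'I_2},
     exists D : T -> T -> nat, forall k x y, reach w0 k x y <-> D x y <= k) ->
  monochromatic (flood_play e w s) -> exists x, forall y, reach w (size s) x y.
Proof.
move=> esym [/card_gt0P[x0 _] econ] hasD; elim: s w => [|[v c] s IH] w /=.
  case=> d wd; exists x0 => y.
  have /connectP[p pth ->] := econ x0 y.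
  elim: p x0 pth => [|z p IHp] x /=; first by move=> _; apply: reach_refl.
  case/andP=> exz pth; apply: (@reach_trans _ _ 0 0 _ z); last exact: IHp.
  by have := reach1 w exz; rewrite !wd eqxx.
move=> /IH; have [D DP] := hasD w; exact: radius_before_move.
Qed.

End TwoColours.
End ColourDistance.

(** * Floyd-Warshall *)

Section FloydWarshall.
Variable W : nat -> nat -> nat.

Fixpoint fw k i j :=
  if k is k'.+1 then minn (fw k' i j) (fw k' i k' + fw k' k' j) else W i j.

(* Round [k] leaves row and column [k] unchanged, hence the matrix may be updated
   in place. *)
Lemma fw_pivotl k j : fw k.+1 k j = fw k k j.
Proof. by rewrite /=; lia. Qed.

(** With this inequality a walk is compared with [fw] edge by edge; no shortest path has to be
    extracted. *)
Lemma fw_triangle k m i j : m < k -> fw k i j <= fw k i m + fw k m j.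
Proof.
elim: k i j => [//|k IH] i j; rewrite ltnS leq_eqVlt => /orP[/eqP -> /=|mk /=].
  by lia.
by move: (IH i j mk) (IH i k mk) (IH k j mk); lia.
Qed.

Lemma fw_leq k i j : fw k i j <= W i j.
Proof. by elim: k i j => [//|k IH] i j /=; have := IH i j; lia. Qed.

End FloydWarshall.

Section Distance.
Variables (n : nat) (e : rel 'I_n) (C : finType) (w : {ffun 'I_n -> C}).
Variable W : nat -> nat -> nat.
Hypothesis econ : forall x y : 'I_n, connect e x y.
Hypothesis Wdiag : forall i : 'I_n, W i i = 0.
Hypothesis Wedge : forall i j : 'I_n, e i j -> W i j = (w i != w j).
Hypothesis Wnone : forall i j : 'I_n, i != j -> ~~ e i j -> n <= W i j.

Lemma fw_reach k (i j : 'I_n) : k <= n -> reach e w (fw W k i j) i j.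
Proof.
elim: k i j => [|k IH] i j kn.
  have [<-|ij] := eqVneq i j; first exact: reach_refl.
  have [eij|nij] := boolP (e i j); first by rewrite /= Wedge //; apply: reach1.
  (* A non-edge weighs at least [n], and connectedness gives a walk with at most [n] changes, so
     this entry too is realised. *)
  apply: (@reach_leq _ _ _ _ n); first exact: Wnone.
  by have := connect_reach w (econ i j); rewrite card_ord.
have kn' := ltnW kn; rewrite /=; have [_|_] := leqP; first exact: IH.
exact: reach_trans (IH i (Ordinal kn) kn') (IH (Ordinal kn) j kn').
Qed.

Lemma reachE k (x y : 'I_n) : reach e w k x y <-> fw W n x y <= k.
Proof.
split=> [|le]; last by apply: reach_leq le _; apply: fw_reach.
elim=> [k0 x0|j k0 x0 y0 z0 _ IH eyz le0].
  by have := fw_leq W n x0 x0; rewrite Wdiag; lia.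
move: le0 (fw_triangle W x0 z0 (ltn_ord y0)) (fw_leq W n y0 z0).
by rewrite -Wedge //; lia.
Qed.

End Distance.

(** * Structured programs for the machine *)

(* [Do c i] repeats [c] while [X_i > 0], and runs it at least once. *)
Inductive cmd : Type :=
| Blk of seq ram_instr
| Seq of cmd & cmd
| Do of cmd & nat.

(** Jump targets are absolute, hence the offset at which the code is placed. *)
Fixpoint compile (off : nat) (c : cmd) : seq ram_instr :=
  match c with
  | Blk s => s
  | Seq c1 c2 => let s := compile off c1 in s ++ compile (off + size s) c2
  | Do c i => rcons (compile off c) (IJump i off)
  end.

(* The registers below 20 are kept as an explicit list, so that straight-line
   code can be run by computation; the other ones serve as memory. *)
Record state : Type := State {
  st_loc : seq nat;
  st_mem : nat -> nat;
  st_in : seq nat;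
  st_out : seq nat
}.

Definition lookup (L : seq nat) (M : nat -> nat) (a : nat) : nat :=
  if a < 20 then nth 0 L a else M a.

Definition represents (pc : nat) (s : state) (c : ram_config) : Prop :=
  [/\ ram_pc c = pc, ram_reg c =1 lookup (st_loc s) (st_mem s),
      ram_in c = st_in s & ram_out c = st_out s].

Definition exec (s : state) (i : ram_instr) : state :=
  let: State L M inp out := s in
  match i with
  | IConst i a => State (set_nth 0 L i a) M inp out
  | IAdd i j k => State (set_nth 0 L i (nth 0 L j + nth 0 L k)) M inp out
  | ISub i j k => State (set_nth 0 L i (nth 0 L j - nth 0 L k)) M inp out
  | ILoad i j => State (set_nth 0 L i (lookup L M (nth 0 L j))) M inp out
  | IStore i j =>
      if nth 0 L i < 20 then State (set_nth 0 L (nth 0 L i) (nth 0 L j)) M inp out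
      else State L (ram_set M (nth 0 L i) (nth 0 L j)) inp out
  | IJump i l => s
  | IRead i => State (set_nth 0 L i (head 0 inp)) M (behead inp) out
  | IPrint i => State L M inp (rcons out (nth 0 L i))
  end.

(** Jumps are excluded because only [Do] generates them. *)
Definition local_instr (i : ram_instr) : bool :=
  match i with
  | IConst i _ | IRead i | IPrint i => i < 20
  | IAdd i j k | ISub i j k => [&& i < 20, j < 20 & k < 20]
  | ILoad i j | IStore i j => (i < 20) && (j < 20)
  | IJump _ _ => false
  end.

Lemma lookup_mem L M a : 20 <= a -> lookup L M a = M a.
Proof. by rewrite /lookup leqNgt => /negbTE ->. Qed.

Lemma lookup_set_loc L M i a : i < 20 ->
  ram_set (lookup L M) i a =1 lookup (set_nth 0 L i a) M.
Proof.
move=> i20 r; rewrite /ram_set /lookup nth_set_nth /=.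
by case: eqP => [->|//]; rewrite i20.
Qed.

Lemma lookup_set_mem L M i a : 20 <= i ->
  ram_set (lookup L M) i a =1 lookup L (ram_set M i a).
Proof.
move=> i20 r; rewrite /ram_set /lookup.
by case: eqP => [->|//]; rewrite ltnNge i20 /=.
Qed.

Lemma eq_ram_set X Y i a : X =1 Y -> ram_set X i a =1 ram_set Y i a.
Proof. by move=> XY r; rewrite /ram_set XY. Qed.

Lemma exec_represents pc s c i : local_instr i -> represents pc s c ->
  represents pc.+1 (exec s i) (ram_exec c i).
Proof.
case: s c => [L M inp out] [pc0 X inp0 out0] li [/= -> XE -> ->].
have loc r : r < 20 -> X r = nth 0 L r by move=> r20; rewrite XE /lookup r20.
have setX j a : j < 20 -> ram_set X j a =1 lookup (set_nth 0 L j a) M.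
  by move=> j20 r; rewrite (eq_ram_set _ _ XE) lookup_set_loc.
case: i li => /= [i a|i j k|i j k|i j|i j|//|i|i].
- by move=> i20; split=> //; apply: setX.
- by case/and3P=> i20 j20 k20; rewrite !loc //; split=> //; apply: setX.
- by case/and3P=> i20 j20 k20; rewrite !loc //; split=> //; apply: setX.
- by case/andP=> i20 j20; rewrite (loc j) // XE; split=> //; apply: setX.
- case/andP=> i20 j20; rewrite !loc //; case: ltnP => lt; split=> //=.
    exact: setX.
  by move=> r; rewrite (eq_ram_set _ _ XE) lookup_set_mem.
- by move=> i20; split=> //; apply: setX.
- by move=> i20; rewrite loc.
Qed.

(** * Hoare triples with a time bound *)

(** Total correctness; quantifying over the surrounding code makes triples composable. *)
Definition hoare (A : state -> Prop) (c : cmd) (B : state -> Prop) (t : nat) :=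
  forall (P1 P2 : ram_program) s cfg,
    let code := compile (size P1) c in
    let P := P1 ++ code ++ P2 in
    A s -> represents (size P1) s cfg ->
    exists k s', [/\ k <= t, B s' &
      represents (size P1 + size code) s' (iter k (ram_step P) cfg)].

Lemma ram_step_at P1 i P2 s cfg : represents (size P1) s cfg ->
  ram_step (P1 ++ i :: P2) cfg = ram_exec cfg i.
Proof.
case=> pcE _ _ _; rewrite /ram_step pcE.
by have -> : onth (P1 ++ i :: P2) (size P1) = Some i by elim: P1 {pcE}.
Qed.

Lemma hoare_blk (A B : state -> Prop) l : all local_instr l ->
  (forall s, A s -> B (foldl exec s l)) -> hoare A (Blk l) B (size l).
Proof.
move=> ll AB P1 P2 s cfg /= As rep.
exists (size l), (foldl exec s l); split=> //; first exact: AB.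
elim: l ll P1 s cfg {As AB} rep => [|i l IH] /= ll P1 s cfg rep.
  by rewrite addn0.
case/andP: ll => li ll; rewrite -/(iter _ _ _) -iterS iterSr.
rewrite (ram_step_at _ _ rep) -cat_rcons addnS -addSn -(size_rcons P1 i).
by apply: IH => //; rewrite size_rcons; apply: exec_represents.
Qed.

Lemma hoare_seq A B D c1 c2 t1 t2 :
  hoare A c1 B t1 -> hoare B c2 D t2 -> hoare A (Seq c1 c2) D (t1 + t2).
Proof.
move=> h1 h2 P1 P2 s cfg /= As rep.
set l1 := compile (size P1) c1; set l2 := compile _ c2.
have [k1 [s1 [le1 Bs1 rep1]]] := h1 P1 (l2 ++ P2) s cfg As rep.
have := h2 (P1 ++ l1) P2 s1 _ Bs1; rewrite size_cat => /(_ _ rep1).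
case=> k2 [s2 [le2 Ds2]]; rewrite -!catA -/l1 -/l2 -iterD -addnA => rep2.
exists (k2 + k1), s2; split=> //; first by lia.
by rewrite size_cat.
Qed.

(** The counter [n - k] makes the closing jump fall through exactly after round [n]; [0 < n] is
    required since the body runs before the test. The jump costs the extra step per round. *)
Lemma hoare_do (I : nat -> state -> Prop) n c i t : 0 < n -> i < 20 ->
  (forall k s, k <= n -> I k s -> nth 0 (st_loc s) i = n - k) ->
  (forall k, k < n -> hoare (I k) c (I k.+1) t) ->
  hoare (I 0) (Do c i) (I n) (n * t.+1).
Proof.
move=> n0 i20 Icnt body P1 P2 s cfg; rewrite /= size_rcons.
set l := compile _ c; set P := _ ++ _.
have PE : P = P1 ++ l ++ IJump i (size P1) :: P2 by rewrite /P cat_rcons.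
suff loop m k s0 cfg0 : k + m.+1 = n -> I k s0 -> represents (size P1) s0 cfg0 ->
    exists k' s', [/\ k' <= m.+1 * t.+1, I n s' &
      represents (size P1 + (size l).+1) s' (iter k' (ram_step P) cfg0)].
  by case: n n0 loop {body Icnt} => // m _ loop; apply: loop.
elim: m k s0 cfg0 => [|m IH] k s0 cfg0 km Ik rep.
all: have [|k1 [s1 [le1 I1 rep1]]] :=
  body k _ P1 (IJump i (size P1) :: P2) s0 cfg0 Ik rep; first by lia.
all: rewrite -/l -PE in rep1.
all: have := @ram_step_at (P1 ++ l) (IJump i (size P1)) P2 s1.
all: rewrite size_cat -catA -PE => /(_ _ rep1); rewrite -iterS => stepE.
all: have [pc1 reg1 in1 out1] := rep1.
all: have := reg1 i; rewrite /lookup i20 (Icnt k.+1) //; last by lia.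
  move=> Xi; have kn : k.+1 = n by lia.
  exists k1.+1, s1; rewrite -kn; split=> //; first by lia.
  rewrite stepE; case: (iter _ _ _) pc1 reg1 in1 out1 Xi => pc X inp out /=.
  move=> -> reg1 in1 out1 Xi; split=> //=.
  by rewrite Xi kn subnn /= addnS.
move=> Xi.
have rep2 : represents (size P1) s1 (iter k1.+1 (ram_step P) cfg0).
  rewrite stepE; case: (iter _ _ _) pc1 reg1 in1 out1 Xi => pc X inp out /=.
  move=> -> reg1 in1 out1 Xi; split=> //=.
  by have -> : 0 < X i by rewrite Xi; lia.
have [|k2 [s2 [le2 I2 rep3]]] := IH k.+1 s1 _ _ I1 rep2; first by lia.
by exists (k2 + k1.+1), s2; split; [lia | | rewrite iterD].
Qed.

Lemma ram_step_halted P c t : ram_halted P c -> iter t (ram_step P) c = c.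
Proof.
move=> hc; elim: t => //= t ->; rewrite /ram_step.
suff -> : onth P (ram_pc c) = None by [].
move: hc; rewrite /ram_halted; elim: P (ram_pc c) => [|i P IH] [|pc] //=.
exact: IH.
Qed.

Lemma hoare_outputs A c inp output t T : t <= T ->
  A (State (nseq 20 0) (fun=> 0) inp [::]) ->
  hoare A c (fun s => st_out s = output) t ->
  ram_outputs_within (compile 0 c) inp T output.
Proof.
move=> tT As h.
have [|k [s [kt outE [pcE _ _ oE]]]] := h [::] [::] _ (ram_init inp) As.
  split=> //= r; rewrite /lookup; case: ltnP => // r20.
  by rewrite (nth_nseq 0 20 0 r) r20.
rewrite /= cats0 in pcE oE.
have hk : ram_halted (compile 0 c) (iter k (ram_step (compile 0 c)) (ram_init inp)).
  by rewrite /ram_halted pcE.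
(* The remaining time is spent in the halted configuration, a fixed point of the step function. *)
rewrite /ram_outputs_within /= -(subnK (leq_trans kt tT)) iterD ram_step_halted //.
by rewrite oE outE.
Qed.

(** * The program *)

(* Registers: 0 holds 0, 1 holds 1, 2 holds n; the pair (3, 4) is the table
   (n, 0) with its address in 5; the colours start at 20 (register 6), the
   distance matrix at 20 + n (register 7); 8 points to the current matrix entry. *)

Definition read_colours : cmd :=
  Seq (Blk [:: IRead 2; IConst 1 1; IAdd 3 2 0; IConst 5 3; IConst 6 20;
               IAdd 7 6 2; IAdd 8 6 0; IAdd 9 2 0])
      (Do (Blk [:: IRead 13; IStore 8 13; IAdd 8 8 1; ISub 9 9 1]) 9).

(* Adjacency plus the test for the diagonal selects n or 0 from the table; the
   colour difference is added to it. *)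
Definition read_entry : seq ram_instr :=
  [:: IRead 13; ILoad 14 10; ILoad 15 12; ISub 16 14 15; ISub 15 15 14;
      IAdd 15 15 16; ISub 14 9 11; ISub 16 11 9; IAdd 14 14 16; ISub 14 1 14;
      IAdd 13 13 14; IAdd 13 13 5; ILoad 13 13; IAdd 13 13 15; IStore 8 13;
      IAdd 8 8 1; IAdd 12 12 1; ISub 11 11 1].

Definition read_matrix : cmd :=
  Seq (Blk [:: IAdd 8 7 0; IAdd 10 6 0; IAdd 9 2 0])
      (Do (Seq (Blk [:: IAdd 12 6 0; IAdd 11 2 0])
          (Seq (Do (Blk read_entry) 11)
               (Blk [:: IAdd 10 10 1; ISub 9 9 1]))) 9).

(** The subtractions compute [a - (a - b) = minn a b]. Register 13 holds the pivot-column entry of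
    the current row; 12 walks along the pivot row. *)
Definition relax_entry : seq ram_instr :=
  [:: ILoad 14 12; IAdd 14 14 13; ILoad 15 8; ISub 16 15 14; ISub 15 15 16;
      IStore 8 15; IAdd 8 8 1; IAdd 12 12 1; ISub 11 11 1].

Definition relax_row : cmd :=
  Seq (Blk [:: IAdd 12 19 0; IAdd 11 2 0; ILoad 13 10])
 (Seq (Do (Blk relax_entry) 11)
      (Blk [:: IAdd 10 10 2; ISub 9 9 1])).

(** Registers 18 and 19 hold the addresses where the pivot column and the pivot row start. *)
Definition relax_all : cmd :=
  Seq (Blk [:: IAdd 17 2 0; IAdd 18 7 0; IAdd 19 7 0])
      (Do (Seq (Blk [:: IAdd 8 7 0; IAdd 10 18 0; IAdd 9 2 0])
          (Seq (Do relax_row 9)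
               (Blk [:: IAdd 18 18 1; IAdd 19 19 2; ISub 17 17 1]))) 17).

(** Register 18 accumulates a row maximum by [a + (b - a)], register 17 the minimum of these
    maxima. *)
Definition print_radius : cmd :=
  Seq (Blk [:: IAdd 8 7 0; IAdd 17 2 0; IAdd 9 2 0])
 (Seq (Do (Seq (Blk [:: IConst 18 0; IAdd 11 2 0])
          (Seq (Do (Blk [:: ILoad 13 8; ISub 13 13 18; IAdd 18 18 13; IAdd 8 8 1;
                            ISub 11 11 1]) 11)
               (Blk [:: ISub 13 17 18; ISub 17 17 13; ISub 9 9 1]))) 9)
      (Blk [:: IPrint 17])).

Definition flood_program : cmd :=
  Seq read_colours (Seq read_matrix (Seq relax_all print_radius)).

Fixpoint row_max (f : nat -> nat -> nat) i j :=
  if j is j'.+1 then maxn (row_max f i j') (f i j') else 0.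

(** On a distance matrix this is the radius. The start value [n] is safe, as no eccentricity in a
    connected graph exceeds it. *)
Fixpoint min_row_max (f : nat -> nat -> nat) n i :=
  if i is i'.+1 then minn (min_row_max f n i') (row_max f i' n) else n.

Lemma index_inj n i j i' j' :
  j < n -> j' < n -> i * n + j = i' * n + j' -> i = i' /\ j = j'.
Proof.
move=> jn j'n E; have ii' : i = i'.
  have n0 : 0 < n by lia.
  by have := congr1 (divn^~ n) E; rewrite !divnMDl // !divn_small // !addn0.
by split=> //; move: E; rewrite ii' => /addnI.
Qed.

Lemma lookup20 L M a : lookup L M (20 + a) = M (20 + a).
Proof. by rewrite lookup_mem // leq_addr. Qed.

Lemma ltn20 a : (20 + a < 20) = false.
Proof. by rewrite ltnNge leq_addr. Qed.

(** * Correctness of the machine program, loop by loop *)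

Section Correctness.
Variables (n : nat) (rest : seq nat).
Hypothesis n_gt0 : 0 < n.

Let colour i := nth 0 rest i.
Let adj i j := nth 0 rest (n + (i * n + j)).

Hypothesis adj01 : forall i j, i < n -> j < n -> adj i j + (i == j) <= 1.

(** The two truncated differences add up to the absolute difference, which for colours 0 and 1
    indicates a change. *)
Definition weight i j :=
  (if adj i j + (i == j) == 0 then n else 0) +
  ((colour j - colour i) + (colour i - colour j)).

(** Registers 0 to 7 stay constant after initialisation; the arguments are registers 8 to 19 in
    order. *)
Definition locals p ci pi cj pj a b c d ck pk qk : seq nat :=
  [:: 0; 1; n; n; 0; 3; 20; 20 + n; p; ci; pi; cj; pj; a; b; c; d; ck; pk; qk].

Definition entry i j := 20 + (n + (i * n + j)).

Ltac run :=
  lazy beta iota delta [foldl exec locals nth set_nth read_entry relax_entry];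
  rewrite ?ltn20; lazy beta iota delta [foldl exec locals nth set_nth].

Ltac eq_state := rewrite /locals /entry; apply: f_equal4;
  [ repeat (apply: f_equal2; [first [reflexivity | rewrite /=; lia] | ]); reflexivity
  | reflexivity
  | first [reflexivity | apply: (congr1 (fun k => drop k rest)); lia]
  | reflexivity ].

Lemma behead_drop k (s : seq nat) : behead (drop k s) = drop k.+1 s.
Proof. by rewrite -drop1 drop_drop add1n. Qed.

Lemma head_drop k (s : seq nat) : head 0 (drop k s) = nth 0 s k.
Proof. by rewrite -nth0 nth_drop addn0. Qed.

Definition colours_read M := forall v, v < n -> M (20 + v) = colour v.

Definition colours_inv k s := exists M a,
  s = State (locals (20 + k) (n - k) 0 0 0 a 0 0 0 0 0 0) M (drop k rest) [::] /\
  forall v, v < k -> M (20 + v) = colour v.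

Lemma read_colours_correct :
  hoare (fun s => s = State (nseq 20 0) (fun=> 0) (n :: rest) [::])
    read_colours (colours_inv n) (8 + n * 5).
Proof.
apply: (@hoare_seq _ (colours_inv 0)).
  apply: hoare_blk => // _ ->; do 2 eexists; split=> //=.
  by rewrite drop0; eq_state.
apply: hoare_do => // [k _ _ [M [a [-> _]]] //|].
move=> k kn; apply: hoare_blk => // _ [M [a [-> Mk]]].
run; rewrite head_drop behead_drop; do 2 eexists; split; first by eq_state.
move=> v; rewrite ltnS leq_eqVlt /ram_set => /orP[/eqP->|vk].
  by rewrite eqxx.
by rewrite ifN ?Mk //; lia.
Qed.

Definition filled (M : nat -> nat) f q :=
  forall i j, i < n -> j < n -> i * n + j < q -> M (entry i j) = f i j.

Lemma filled_set M f i j a : j < n -> a = f i j -> filled M f (i * n + j) ->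
  filled (ram_set M (entry i j) a) f (i * n + j.+1).
Proof.
move=> jn aE Mf i' j' i'n j'n lt; rewrite /ram_set /entry !eqn_add2l.
case: eqP => [/(index_inj j'n jn)[-> ->]//|ne].
by rewrite -/(entry i' j') Mf //; lia.
Qed.

Definition matrix_inv i j s := exists M a b c d,
  s = State (locals (entry i j) (n - i) (20 + i) (n - j) (20 + j) a b c d 0 0 0)
        M (drop (n + (i * n + j)) rest) [::] /\
  (colours_read M /\ filled M weight (i * n + j)).

Definition matrix_row_inv i s := exists M cj pj a b c d,
  s = State (locals (entry i 0) (n - i) (20 + i) cj pj a b c d 0 0 0)
        M (drop (n + i * n) rest) [::] /\
  (colours_read M /\ filled M weight (i * n)).

Lemma read_entry_correct i j : i < n -> j < n ->
  hoare (matrix_inv i j) (Blk read_entry) (matrix_inv i j.+1) 18.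
Proof.
move=> i_n j_n; apply: hoare_blk => // _ [M [a [b [c [d [-> [Mc Mw]]]]]]].
rewrite /entry; run.
rewrite !lookup20 head_drop behead_drop !Mc //.
(* Registers 9 and 11 count down from [n] with [i] and [j], so comparing them detects the
   diagonal. *)
have -> : 1 - (n - i - (n - j) + (n - j - (n - i))) = (i == j) by case: eqP; lia.
rewrite -/(adj i j) (addnC _ 3).
have lookE p ci pi cj pj a0 b0 c0 d0 : lookup
    [:: 0; 1; n; n; 0; 3; 20; 20 + n; p; ci; pi; cj; pj; a0; b0; c0; d0; 0; 0; 0]
    M (3 + (adj i j + (i == j))) =
    if adj i j + (i == j) == 0 then n else 0.
  (* The selector is 0 or 1, so the load hits register 3, which holds [n], or register 4, which
     holds 0. *)
  by have := adj01 i_n j_n; case: (_ + _) => [|[|]].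
rewrite lookE; do 5 eexists; split; first by eq_state.
split; last exact: filled_set.
by move=> v vn; rewrite /ram_set ifN ?Mc //; lia.
Qed.

Lemma read_matrix_correct :
  hoare (colours_inv n) read_matrix (matrix_row_inv n)
    (3 + n * (2 + (n * 19 + 2)).+1).
Proof.
apply: (@hoare_seq _ (matrix_row_inv 0)).
  apply: hoare_blk => // _ [M [a [-> Mc]]]; run.
  by do 7 eexists; split; [eq_state | split].
apply: hoare_do => // [k _ _ [M [cj [pj [a [b [c [d [-> _]]]]]]]] //|i i_n].
apply: (@hoare_seq _ (matrix_inv i 0)).
  apply: hoare_blk => // _ [M [cj [pj [a [b [c [d [-> Mf]]]]]]]]; run.
  by do 5 eexists; split; [eq_state | rewrite addn0; exact: Mf].
apply: (@hoare_seq _ (matrix_inv i n)).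
  apply: hoare_do => // [k _ _ [M [a [b [c [d [-> _]]]]]] //|j j_n].
  exact: read_entry_correct.
apply: hoare_blk => // _ [M [a [b [c [d [-> Mf]]]]]]; run.
by do 7 eexists; split; [eq_state | rewrite mulSnr; exact: Mf].
Qed.

(** * Floyd-Warshall rounds in place *)

Let F k := fw weight k.

Definition stored (M : nat -> nat) f :=
  forall i j, i < n -> j < n -> M (entry i j) = f i j.

(** Updating in place leaves a matrix that mixes two rounds. *)
Definition relaxed M k q := forall i j, i < n -> j < n ->
  M (entry i j) = F (if i * n + j < q then k.+1 else k) i j.

Definition relax_inv k i j s := exists M inp b c d,
  s = State (locals (entry i j) (n - i) (entry i k) (n - j) (entry k j) (F k i k)
               b c d (n - k) (entry 0 k) (entry k 0)) M inp [::] /\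
  relaxed M k (i * n + j).

Definition relax_row_inv k i s := exists M inp cj pj a b c d,
  s = State (locals (entry i 0) (n - i) (entry i k) cj pj a b c d
               (n - k) (entry 0 k) (entry k 0)) M inp [::] /\
  relaxed M k (i * n).

Definition relax_all_inv k s := exists M inp p ci pi cj pj a b c d,
  s = State (locals p ci pi cj pj a b c d (n - k) (entry 0 k) (entry k 0))
        M inp [::] /\
  stored M (F k).

Lemma relax_entry_correct k i j : k < n -> i < n -> j < n ->
  hoare (relax_inv k i j) (Blk relax_entry) (relax_inv k i j.+1) 9.
Proof.
move=> k_n i_n j_n; apply: hoare_blk => // _ [M [inp [b [c [d [-> Mr]]]]]].
rewrite /entry; run; rewrite !lookup20 -!/(entry _ _).
(* The pivot row may already be overwritten, but round [k] does not alter it, so both cases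
   agree. *)
have -> : M (entry k j) = F k k j.
  by rewrite Mr //; case: ifP => // _; apply: fw_pivotl.
rewrite (Mr i j) // ltnn; do 5 eexists; split; first by eq_state.
move=> i' j' i'n j'n; rewrite /ram_set /entry !eqn_add2l.
case: eqP => [/(index_inj j'n j_n)[-> ->]//|ne].
  by rewrite ifT /F /=; lia.
by rewrite -/(entry i' j') Mr //; congr (F _ i' j'); do 2 case: ltnP => ? //; lia.
Qed.

Lemma relax_row_correct k i : k < n -> i < n ->
  hoare (relax_row_inv k i) relax_row (relax_row_inv k i.+1) (3 + (n * 10 + 2)).
Proof.
move=> k_n i_n; apply: (@hoare_seq _ (relax_inv k i 0)).
  apply: hoare_blk => // _ [M [inp [cj [pj [a [b [c [d [-> Mr]]]]]]]]].
  rewrite /entry; run; rewrite !lookup20 -!/(entry _ _) (Mr i k) //.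
  (* The pivot-column entry is loaded before row [i] is touched, so it belongs to round [k]. *)
  rewrite ifF; last by lia.
  by do 5 eexists; split; [eq_state | rewrite addn0; exact: Mr].
apply: (@hoare_seq _ (relax_inv k i n)).
  apply: hoare_do => // [j _ _ [M [inp [b [c [d [-> _]]]]]] //|j j_n].
  exact: relax_entry_correct.
apply: hoare_blk => // _ [M [inp [b [c [d [-> Mr]]]]]]; run.
by do 8 eexists; split; [eq_state | rewrite mulSnr; exact: Mr].
Qed.

Lemma relax_all_correct :
  hoare (matrix_row_inv n) relax_all (relax_all_inv n)
    (3 + n * (3 + (n * (3 + (n * 10 + 2)).+1 + 3)).+1).
Proof.
apply: (@hoare_seq _ (relax_all_inv 0)).
  apply: hoare_blk => // _ [M [cj [pj [a [b [c [d [-> [_ Mf]]]]]]]]]; run.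
  do 11 eexists; split; first by eq_state.
  by move=> i j i_n j_n; rewrite Mf //; nia.
apply: hoare_do => // [k s _|k k_n].
  by case=> [M [inp [p [ci [pi [cj [pj [a [b [c [d [-> _]]]]]]]]]]]].
apply: (@hoare_seq _ (relax_row_inv k 0)).
  apply: hoare_blk => // _ [M [inp [p [ci [pi [cj [pj [a [b [c [d [-> Ms]]]]]]]]]]]].
  run; do 8 eexists; split; first by eq_state.
  by move=> i j i_n j_n; rewrite Ms.
apply: (@hoare_seq _ (relax_row_inv k n)).
  apply: hoare_do => // [i s _|i i_n]; last exact: relax_row_correct.
  by case=> [M [inp [cj [pj [a [b [c [d [-> _]]]]]]]]].
apply: hoare_blk => // _ [M [inp [cj [pj [a [b [c [d [-> Mr]]]]]]]]]; run.
do 11 eexists; split; first by eq_state.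
by move=> i j i_n j_n; rewrite Mr // ifT //; nia.
Qed.

(** * Eccentricities and radius on the machine *)

Let D := F n.

Definition max_inv i j s := exists M inp pi pj a b c d qk,
  s = State (locals (entry i j) (n - i) pi (n - j) pj a b c d
               (min_row_max D n i) (row_max D i j) qk) M inp [::] /\
  stored M D.

Definition min_inv i s := exists M inp pi cj pj a b c d pk qk,
  s = State (locals (entry i 0) (n - i) pi cj pj a b c d
               (min_row_max D n i) pk qk) M inp [::] /\
  stored M D.

Lemma print_radius_correct :
  hoare (relax_all_inv n) print_radius
    (fun s => st_out s = [:: min_row_max D n n])
    (3 + (n * (2 + (n * 6 + 3)).+1 + 1)).
Proof.
apply: (@hoare_seq _ (min_inv 0)).
  apply: hoare_blk => // _ [M [inp [p [ci [pi [cj [pj [a [b [c [d [-> Ms]]]]]]]]]]]].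
  by run; do 11 eexists; split; [eq_state | exact: Ms].
apply: (@hoare_seq _ (min_inv n)); last first.
  apply: hoare_blk => // _ [M [inp [pi [cj [pj [a [b [c [d [pk [qk [-> _]]]]]]]]]]]].
  by [].
apply: hoare_do => // [i s _|i i_n].
  by case=> [M [inp [pi [cj [pj [a [b [c [d [pk [qk [-> _]]]]]]]]]]]].
apply: (@hoare_seq _ (max_inv i 0)).
  apply: hoare_blk => // _ [M [inp [pi [cj [pj [a [b [c [d [pk [qk [-> Ms]]]]]]]]]]]].
  by run; do 9 eexists; split; [eq_state | exact: Ms].
apply: (@hoare_seq _ (max_inv i n)).
  apply: hoare_do => // [j s _|j j_n].
    by case=> [M [inp [pi [pj [a [b [c [d [qk [-> _]]]]]]]]]].
  apply: hoare_blk => // _ [M [inp [pi [pj [a [b [c [d [qk [-> Ms]]]]]]]]]].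
  rewrite /entry; run; rewrite lookup20 -/(entry _ _) Ms //.
  have -> : row_max D i j + (D i j - row_max D i j) = row_max D i j.+1.
    by rewrite /=; lia.
  by do 9 eexists; split; [eq_state | exact: Ms].
apply: hoare_blk => // _ [M [inp [pi [pj [a [b [c [d [qk [-> Ms]]]]]]]]]]; run.
have -> : min_row_max D n i - (min_row_max D n i - row_max D i n)
        = min_row_max D n i.+1 by rewrite /=; lia.
by do 11 eexists; split; [eq_state | exact: Ms].
Qed.

Lemma flood_program_correct t : 200 * n ^ 3 <= t ->
  ram_outputs_within (compile 0 flood_program) (n :: rest) t
    [:: min_row_max D n n].
Proof.
move=> le_t; have := hoare_seq read_colours_correct (hoare_seq read_matrix_correct
  (hoare_seq relax_all_correct print_radius_correct)).
apply: hoare_outputs => //; apply: leq_trans le_t.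
(* The bounds add up to [10n^3 + 31n^2 + 23n + 18], at most [82n^3] as [n > 0]. *)
by rewrite !expnS expn0; nia.
Qed.

End Correctness.

(** * Row maxima, their minimum, and row-major indexing *)

Lemma row_max_leq f i j r : row_max f i j <= r <-> forall j', j' < j -> f i j' <= r.
Proof.
elim: j => [|j IH] /=; first by split.
rewrite geq_max; split=> [/andP[/IH le1 le2] j'|le1].
  by rewrite ltnS leq_eqVlt => /orP[/eqP->|/le1].
apply/andP; split; last exact: le1.
by apply/IH => j' lt; apply: le1; apply: ltnW.
Qed.

Lemma min_row_max_leq f n i k : i < k -> min_row_max f n k <= row_max f i n.
Proof.
elim: k => // k IH; rewrite ltnS leq_eqVlt => /orP[/eqP->|/IH] /=; lia.
Qed.

Lemma min_row_max_attained f n k :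
  min_row_max f n k = n \/ exists2 i, i < k & min_row_max f n k = row_max f i n.
Proof.
elim: k => [|k IH] /=; first by left.
have [le|lt] := leqP (min_row_max f n k) (row_max f k n).
  case: IH => [->|[i ik ->]]; [by left | right].
  by exists i => //; apply: ltnW.
by right; exists k.
Qed.

Lemma nth_allpairs (S S' : Type) (x0 : S) (y0 : S') (f : S -> S' -> nat) s t i j :
  i < size s -> j < size t ->
  nth 0 [seq f x y | x <- s, y <- t] (i * size t + j) = f (nth x0 s i) (nth y0 t j).
Proof.
elim: s i => // x s IH [|i] /= lti ltj; rewrite nth_cat size_map.
  by rewrite mul0n ltj (nth_map y0).
rewrite ifF; last by nia.
by rewrite (_ : _ - _ = i * size t + j) ?IH //; nia.
Qed.

(** * Instances *)

Section Instance.
Variables (n : nat) (e : rel 'I_n) (w : {ffun 'I_n -> 'I_2}).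

Definition instance_tail : seq nat :=
  [seq (w v : nat) | v <- enum 'I_n] ++
  [seq nat_of_bool (e u v) | u <- enum 'I_n, v <- enum 'I_n].

Lemma instance_colour (i : 'I_n) : nth 0 instance_tail i = w i.
Proof.
rewrite nth_cat size_map size_enum_ord ltn_ord (nth_map i) ?size_enum_ord //.
by rewrite nth_ord_enum.
Qed.

Lemma instance_adj (i j : 'I_n) : nth 0 instance_tail (n + (i * n + j)) = e i j.
Proof.
rewrite nth_cat size_map size_enum_ord ifF; last by lia.
have := @nth_allpairs _ _ i j (fun u v => nat_of_bool (e u v))
  (enum 'I_n) (enum 'I_n) i j.
by rewrite addKn size_enum_ord !nth_ord_enum => ->.
Qed.

Let W := weight n instance_tail.

Lemma reach_weightE k (x y : 'I_n) : (forall x y : 'I_n, connect e x y) ->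
  reach e w k x y <-> fw W n x y <= k.
Proof.
move=> econ; apply: reachE => // [i|i j eij|i j ij nij]; rewrite /W /weight.
- by rewrite eqxx addn1 subnn.
- rewrite !instance_adj eij !instance_colour /=.
  by case: (w i) (w j) => [[|[|?]] ?] [[|[|?]] ?].
- rewrite !instance_adj (negbTE nij) -val_eqE in ij *.
  by rewrite (negbTE ij) leq_addr.
Qed.

Hypothesis eirr : irreflexive e.

Lemma instance_adj01 i j : i < n -> j < n ->
  nth 0 instance_tail (n + (i * n + j)) + (i == j) <= 1.
Proof.
move=> i_n j_n; rewrite (instance_adj (Ordinal i_n) (Ordinal j_n)).
case: eqP => [ij|_]; last by case: (e _ _).
have -> : Ordinal j_n = Ordinal i_n by apply: val_inj.
by rewrite eirr.
Qed.

End Instance.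

Lemma min_moves_radius n (e : rel 'I_n) (w : {ffun 'I_n -> 'I_2}) :
  symmetric e -> connected_graph e ->
  min_moves e w (min_row_max (fw (weight n (instance_tail e w)) n) n n).
Proof.
move=> esym econn; have [n0 econ] := econn; rewrite card_ord in n0.
set D := fw _ n; split=> [|s mono].
  apply: radius_play; case: (min_row_max_attained D n n) => [->|[i i_n ->]].
    (* If the minimum is the start value [n], any vertex serves as centre. *)
    exists (Ordinal n0) => y.
    by have := connect_reach w (econ (Ordinal n0) y); rewrite card_ord.
  exists (Ordinal i_n) => y; apply/reach_weightE => //.
  by move: (y : nat) (ltn_ord y); apply/row_max_leq.
have [|x rx] := play_radius esym econn _ mono.
  (* The matrix computed for each colouring supplies its distance function. *)
  move=> w0; pose D0 := fw (weight n (instance_tail e w0)) n.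
  by exists (fun x y : 'I_n => D0 x y) => k x y; apply: reach_weightE.
apply: leq_trans (min_row_max_leq _ _ (ltn_ord x)) _.
apply/row_max_leq => j j_n.
by have [le_s _] := reach_weightE w (size s) x (Ordinal j_n) econ; apply: le_s.
Qed.

Theorem theorem3p2 :
  exists (P : ram_program) (p : {poly nat}),
    forall (n : nat) (e : rel 'I_n) (w : {ffun 'I_n -> 'I_2}),
      simple_graph e -> connected_graph e ->
      exists m : nat,
        min_moves e w m /\
        ram_outputs_within P (encode_instance e w)
          (p.[graph_size e])%R [:: m].
Proof.
(* Coefficients run from degree 0 upwards: the polynomial is [200 X^3]. *)
exists (compile 0 flood_program), (Poly [:: 0; 0; 0; 200]).
move=> n e w [esym eirr] econn.
exists (min_row_max (fw (weight n (instance_tail e w)) n) n n).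
split; first exact: min_moves_radius.
have [n0 _] := econn; rewrite card_ord in n0.
apply: flood_program_correct => //; first exact: instance_adj01.
have : n <= graph_size e by rewrite /graph_size card_ord leq_addr.
move: (graph_size e) => N nN; rewrite horner_Poly.
(* Horner evaluation in the semiring [nat] is convertible to ordinary arithmetic. *)
change (200 * n ^ 3 <= (((0 * N + 200) * N + 0) * N + 0) * N + 0).
have : n ^ 3 <= N ^ 3 by rewrite leq_exp2r.
by rewrite !expnS expn0; lia.
Qed.
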